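(* Let $X,Y$ be coarse spaces. If bornologous maps $f,g\colon X\to Y$ are bornotopic, then $\mathcal{Q}(f)=\mathcal{Q}(g)$ as maps $\mathcal{Q}(X)\to\mathcal{Q}(Y)$.
   Context: For binary relations $E,F\subseteq X\times X$: $E\circ F=\{(x,y) : (x,z)\in E \text{ and } (z,y)\in F \text{ for some } z\in X\}$, $E^{-1}=\{(y,x):(x,y)\in E\}$, $\Delta_X=\{(x,x):x\in X\}$. For maps $f,g\colon X\to Y$, $(f\times g)(E)=\{(f(x),g(y)):(x,y)\in E\}$. A coarse structure on a set $X$ is a family $\mathcal{C}_X$ of binary relations on $X$ such that $\Delta_X\in\mathcal{C}_X$; $E\subseteq F\in\mathcal{C}_X$ implies $E\in\mathcal{C}_X$; and $E,F\in\mathcal{C}_X$ implies $E\cup F, E\circ F, E^{-1}\in\mathcal{C}_X$. A set with a coarse structure is a coarse space. A subset $A\subseteq X$ is bounded if $A\times A\in\mathcal{C}_X$; $\mathcal{B}_X$ is the family of bounded subsets. A map $f\colon X\to Y$ between coarse spaces is bornologous if $(f\times f)(E)\in\mathcal{C}_Y$ for all $E\in\mathcal{C}_X$. Maps $f,g\colon X\to Y$ into a coarse space $Y$ are bornotopic (close) if $(f\times g)(\Delta_X)\in\mathcal{C}_Y$. For a coarse space $X$ and $x\in X$, the coarsely connected component of $X$ containing $x$ is $\mathcal{Q}_X(x)=\bigcup\{B : x\in B\in\mathcal{B}_X\}$, and $\mathcal{Q}(X)=\{\mathcal{Q}_X(x): x\in X\}$. For a bornologous map $f\colon X\to Y$,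 $\mathcal{Q}(f)\colon\mathcal{Q}(X)\to\mathcal{Q}(Y)$ is the (well-defined) map $\mathcal{Q}(f)(\mathcal{Q}_X(x))=\mathcal{Q}_Y(f(x))$. *)

(* Defs.v *)
From mathcomp Require Import all_boot all_classical.

Set Implicit Arguments.
Unset Strict Implicit.
Unset Printing Implicit Defensive.

Local Open Scope classical_set_scope.

(* [F \; E] relates x to y when E (x, z) and F (z, y) for some z, so it is the
   composite written E o F (first E, then F) in the coarse-geometry literature;
   [E^-1%relation] is the inverse relation. *)
Record coarse_structure (X : Type) (C : set (set (X * X))) : Prop := {
  coarse_diagonal : C diagonal ;
  coarse_subset : forall E F, E `<=` F -> C F -> C E ;
  coarse_union : forall E F, C E -> C F -> C (E `|` F) ;
  coarse_comp : forall E F, C E -> C F -> C (F \; E)%relation ;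
  coarse_inverse : forall E, C E -> C (E^-1)%relation }.

Record coarseSpace := CoarseSpace {
  coarse_sort :> Type ;
  controlled : set (set (coarse_sort * coarse_sort)) ;
  controlledP : coarse_structure controlled }.

Arguments controlled : clear implicits.

Definition map_prod (X Y : Type) (f g : X -> Y) (p : X * X) : Y * Y :=
  (f p.1, g p.2).

Definition bounded (X : coarseSpace) (A : set X) : Prop :=
  controlled X (A `*` A).

Definition bornologous (X Y : coarseSpace) (f : X -> Y) : Prop :=
  forall E, controlled X E -> controlled Y (map_prod f f @` E).

Definition bornotopic (X : Type) (Y : coarseSpace) (f g : X -> Y) : Prop :=
  controlled Y (map_prod f g @` diagonal).

Definition component (X : coarseSpace) (x : X) : set X :=
  \bigcup_(B in [set B : set X | B x /\ bounded B]) B.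

Definition components (X : coarseSpace) : set (set X) := range (@component X).

Arguments components : clear implicits.

Lemma mem_components (X : coarseSpace) (x : X) :
  component x \in components X.
Proof. by apply: mem_set; exists x. Qed.

(* [components X] is coerced to the type of its elements by [set_type]. *)
Definition component_of (X : coarseSpace) (x : X) : components X :=
  exist _ (component x) (mem_components x).

Lemma component_ofP (X : coarseSpace) (A : components X) :
  exists x, A = component_of x.
Proof.
case: A => A hA; have [x _ xA] := set_mem hA.
by exists x; apply: val_inj => /=.
Qed.

Lemma bounded1 (X : coarseSpace) (x : X) : bounded [set x].
Proof.
have hX := controlledP X.
apply: (coarse_subset hX) (coarse_diagonal hX) => -[a b] /= [/= -> ->].
exact/diagonalP.
Qed.

Lemma component_refl (X : coarseSpace) (x : X) : component x x.
Proof. by exists [set x] => //; split=> //; exact: bounded1. Qed.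

Lemma boundedU (X : coarseSpace) (A B : set X) (z : X) :
  A z -> B z -> bounded A -> bounded B -> bounded (A `|` B).
Proof.
move=> Az Bz bA bB; have hX := controlledP X.
apply: (coarse_subset hX) (coarse_comp hX (coarse_union hX bA bB)
  (coarse_union hX bA bB)) => -[a b] /= [/= ha hb].
by exists z => /=; [case: ha; [left|right] | case: hb; [left|right]].
Qed.

Lemma component_eq (X : coarseSpace) (x y : X) :
  component x y -> component x = component y.
Proof.
case=> A [Ax bA] Ay; apply/seteqP; split=> z [B [Bw bB] Bz].
- by exists (A `|` B); [split; [left | exact: (boundedU Ax)] | right].
- by exists (A `|` B); [split; [left | exact: (boundedU Ay)] | right].
Qed.

Lemma bounded_image (X Y : coarseSpace) (f : X -> Y) (A : set X) :
  bornologous f -> bounded A -> bounded (f @` A).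
Proof.
move=> hf bA; have hY := controlledP Y.
apply: (coarse_subset hY) (hf _ bA).
by move=> [_ _] /= [[a Aa <-] [b Ab <-]]; exists (a, b).
Qed.

Lemma component_image (X Y : coarseSpace) (f : X -> Y) (x y : X) :
  bornologous f -> component x = component y ->
  component (f x) = component (f y).
Proof.
move=> hf xy; apply: component_eq.
have [A [Ax bA] Ay] : component x y by rewrite xy; exact: component_refl.
by exists (f @` A); [split; [exists x | exact: bounded_image] | exists y].
Qed.

Lemma components_map_exists (X Y : coarseSpace) (f : X -> Y) :
  bornologous f ->
  exists h : components X -> components Y,
    forall x, h (component_of x) = component_of (f x).
Proof.
move=> hf; exists (fun A => component_of (f (sval (cid (component_ofP A))))).
move=> x; case: cid => y /= xy; apply: val_inj => /=.
by apply: component_image => //; have /(congr1 val) := xy.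
Qed.

(* [components_mapE] and [components_map_unique] below characterize the map. *)
Definition components_map (X Y : coarseSpace) (f : X -> Y)
    (hf : bornologous f) : components X -> components Y :=
  sval (cid (components_map_exists hf)).

Lemma components_mapE (X Y : coarseSpace) (f : X -> Y) (hf : bornologous f)
    (x : X) :
  components_map hf (component_of x) = component_of (f x).
Proof. by rewrite /components_map; case: cid. Qed.

Lemma components_map_unique (X Y : coarseSpace) (f : X -> Y)
    (hf : bornologous f) (h : components X -> components Y) :
  (forall x, h (component_of x) = component_of (f x)) ->
  h = components_map hf.
Proof.
move=> hE; apply/funext => A; have [x ->] := component_ofP A.
by rewrite components_mapE.
Qed.

(* Main.v *)
Require Import Defs.
From mathcomp Require Import all_boot all_classical.

(** The points [f x] and [g x] form a pair of the controlled relation that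
    witnesses closeness of [f] and [g], and two points related by a controlled
    relation always lie in a common bounded set, namely the doubleton they
    form ([component_controlled]). Hence [f x] and [g x] have the same
    component for every [x]. A map on components is determined by its values
    on the components of points, so the two induced maps coincide. *)

Local Open Scope classical_set_scope.

(** The square of the doubleton [[set x; y]] consists of two diagonal pairs,
    the pair [(x, y)] and its reverse, so the diagonal, [E] and the inverse of
    [E] together cover it. *)
Lemma component_controlled (X : coarseSpace) (E : set (X * X)) (x y : X) :
  controlled X E -> E (x, y) -> component x y.
Proof.
move=> cE Exy; have hX := controlledP X.
exists [set x; y]; last by right.
split; first by left.
apply: (coarse_subset hX) (coarse_union hX (coarse_diagonal hX)
  (coarse_union hX cE (coarse_inverse hX cE))) => -[a b] /= [/= [] -> [] ->].
- by left; exact/diagonalP.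
- by right; left.
- by right; right.
- by left; exact/diagonalP.
Qed.

Theorem theorem2p3 (X Y : coarseSpace) (f g : X -> Y)
    (hf : bornologous f) (hg : bornologous g) :
  bornotopic f g -> components_map hf = components_map hg.
Proof.
move=> fg; apply: components_map_unique => x.
rewrite components_mapE; apply: val_inj => /=.
apply/component_eq/(component_controlled _ _ _ _ fg).
by exists (x, x) => //; exact/diagonalP.
Qed.
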